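(* Let $F:\mathbb{R}\to\mathbb{R}$ be a real analytic $2\pi$-periodic function. Then: (i) There exist two unique $\mathcal{C}^\infty([-1,1])$ functions $f$ and $g$ such that $F(\theta)=f(\sin\theta)+g(\sin\theta)\cos\theta$ for all $\theta\in\mathbb{R}$. (ii) There exist two unique $\mathcal{C}^\infty([-1,1])$ functions $\bar f$ and $\bar g$ such that $F(\theta)=\bar f(\cos\theta)+\bar g(\cos\theta)\sin\theta$ for all $\theta\in\mathbb{R}$.
   Context: A function belongs to $\mathcal{C}^\infty([-1,1])$ if it is $\mathcal{C}^\infty$ in an open neighborhood of $[-1,1]$. Uniqueness is understood for the functions restricted to $[-1,1]$. *)

(* Defs.v *)
From Stdlib Require Import Reals.
From Coquelicot Require Import Coquelicot.
Open Scope R_scope.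

Definition real_analytic (F : R -> R) : Prop :=
  forall x0 : R, exists (a : nat -> R) (r : R),
    0 < r /\ forall x : R, Rabs (x - x0) < r -> is_pseries a (x - x0) (F x).

(* C^oo([-1,1]): the values of the total function f outside U are irrelevant. *)
Definition smooth_I (f : R -> R) : Prop :=
  exists U : R -> Prop,
    open U /\
    (forall x : R, -1 <= x <= 1 -> U x) /\
    (forall (n : nat) (x : R), U x -> ex_derive_n f n x).

Definition eq_on_I (f g : R -> R) : Prop :=
  forall x : R, -1 <= x <= 1 -> f x = g x.

(* Uniqueness of the pair (f, g) is that of the restrictions to [-1,1]. *)
Definition exists_unique_smooth_pair (P : (R -> R) -> (R -> R) -> Prop) : Prop :=
  exists f g : R -> R,
    (smooth_I f /\ smooth_I g /\ P f g) /\
    forall f1 g1 : R -> R,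
      smooth_I f1 -> smooth_I g1 -> P f1 g1 -> eq_on_I f1 f /\ eq_on_I g1 g.

(* Main.v *)
Require Import Defs.
From Stdlib Require Import Reals Ranalysis5 ZArith Lra Lia.
From Coquelicot Require Import Coquelicot.
Open Scope R_scope.

(** The second part is proved directly; the first is the second applied to
    [t => F (PI / 2 - t)], which exchanges sine and cosine.

    Split [F] into its even part [E] and its odd part [O].  An even function of
    period [2 * PI] is determined by its values on [[0, PI]], where [cos] is
    injective, so [f] has to be [E] composed with [acos], and [g] has to be
    [O / sin] composed with [acos].  On the open interval [(-1, 1)] these are
    smooth, since [cos] has a nonzero derivative on [(0, PI)].  The content of
    the theorem is smoothness up to, and a little beyond, the endpoints [1] and
    [-1], where [acos] is not differentiable.

    At [1] analyticity is what helps: splitting the power series of [F] at [0]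
    into even and odd exponents gives [F t = p (t ^ 2) + t * q (t ^ 2)] with [p]
    and [q] sums of power series ([real_analytic_parity_split]), so that
    [E t = p (t ^ 2)] and [O t = t * q (t ^ 2)].  Likewise
    [cos t = c (t ^ 2)] and [sin t = t * s (t ^ 2)] with [c], [s] entire,
    [s 0 = 1] and [c' 0 = - 1 / 2].  The substitution [u = t ^ 2] therefore
    removes the singularity: [c] is a local diffeomorphism at [0], defined also
    for negative [u], and [p] and [q / s] composed with its inverse are smooth on
    both sides of [1].  The same expansion at [PI] treats the endpoint [-1].
    [even_descent] glues the three pieces, for [E] and for [O / sin].

    Everything thus rests on one statement ([smooth_descent]): if [c] and [phi]
    are smooth at [t0] and [c' t0 <> 0], then near [t0] the function [phi] is a
    smooth function of [c].  Its proof avoids a general chain rule of order [n]: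
    with [h] inverse to [c], the derivative of [phi o h] is [(phi' / c') o h],
    again a smooth function composed with [h], so induction applies.

    For uniqueness, comparing the identity at [t] and [- t] separates [f (cos t)]
    from [g (cos t) * sin t]; this determines [g] on [(-1, 1)], and then at the
    endpoints by continuity. *)

(** * Differentiability of finite order *)


(** Recursion on [Derive f], rather than on the last derivative as in
    [ex_derive_n], lets the product, quotient and chain rules be proved by a plain
    induction on the order. *)
Fixpoint diff_at (n : nat) (f : R -> R) (x : R) : Prop :=
  match n with
  | O => True
  | S n => locally x (fun y => ex_derive f y) /\ diff_at n (Derive f) x
  end.

Lemma Derive_ext_locally (f g : R -> R) (x : R) :
  locally x (fun y => f y = g y) -> locally x (fun y => Derive f y = Derive g y).
Proof.
  intro H. generalize (locally_locally _ _ H).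
  apply filter_imp. intros y Hy. now apply Derive_ext_loc.
Qed.

Lemma diff_at_ext_loc (n : nat) (f g : R -> R) (x : R) :
  locally x (fun y => f y = g y) -> diff_at n f x -> diff_at n g x.
Proof.
  revert f g. induction n as [|n IH]; intros f g H; [trivial|].
  intros [H1 H2]. split.
  - generalize (filter_and _ _ (locally_locally _ _ H) H1).
    apply filter_imp. intros y [Hy Hd]. exact (ex_derive_ext_loc f g y Hy Hd).
  - apply (IH (Derive f)); [now apply Derive_ext_locally|exact H2].
Qed.

Lemma diff_at_pred (n : nat) (f : R -> R) (x : R) : diff_at (S n) f x -> diff_at n f x.
Proof.
  revert f. induction n as [|n IH]; intros f [H1 H2]; [exact I|].
  split; [exact H1|]. now apply IH.
Qed.

Lemma diff_at_plus (n : nat) (f g : R -> R) (x : R) :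
  diff_at n f x -> diff_at n g x -> diff_at n (fun y => f y + g y) x.
Proof.
  revert f g. induction n as [|n IH]; intros f g; [trivial|].
  intros [F1 F2] [G1 G2]. assert (FG := filter_and _ _ F1 G1). split.
  - revert FG. apply filter_imp. intros y [Hf Hg].
    exact (ex_derive_plus (V := R_NormedModule) f g y Hf Hg).
  - apply (diff_at_ext_loc n (fun y => Derive f y + Derive g y)).
    + revert FG. apply filter_imp. intros y [Hf Hg]. symmetry. now apply Derive_plus.
    + now apply IH.
Qed.

Lemma diff_at_mult (n : nat) (f g : R -> R) (x : R) :
  diff_at n f x -> diff_at n g x -> diff_at n (fun y => f y * g y) x.
Proof.
  revert f g. induction n as [|n IH]; intros f g; [trivial|].
  intros Hf Hg. destruct (Hf) as [F1 F2]. destruct (Hg) as [G1 G2].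
  assert (FG := filter_and _ _ F1 G1). split.
  - revert FG. apply filter_imp. intros y [Df Dg]. now apply ex_derive_mult.
  - apply (diff_at_ext_loc n (fun y => Derive f y * g y + f y * Derive g y)).
    + revert FG. apply filter_imp. intros y [Df Dg]. symmetry. now apply Derive_mult.
    + apply diff_at_plus; apply IH; trivial; now apply diff_at_pred.
Qed.

Lemma diff_at_scal (n : nat) (a : R) (f : R -> R) (x : R) :
  diff_at n f x -> diff_at n (fun y => a * f y) x.
Proof.
  revert f. induction n as [|n IH]; intros f; [trivial|].
  intros [F1 F2]. split.
  - revert F1. apply filter_imp. intros y Df. now apply ex_derive_scal.
  - apply (diff_at_ext_loc n (fun y => a * Derive f y)).
    + apply filter_forall. intro y. symmetry. apply Derive_scal.
    + now apply IH.
Qed.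

Lemma continuous_locally_neq (f : R -> R) (x : R) :
  continuous f x -> f x <> 0 -> locally x (fun y => f y <> 0).
Proof.
  intros Hf Hx. apply (Hf (fun z => z <> 0)). exact (open_neq 0 (f x) Hx).
Qed.

(** Induction works because [(1 / f)' = - f' * (1 / f) * (1 / f)] involves [1 / f]
    only to the previous order. *)
Lemma diff_at_inv (n : nat) (f : R -> R) (x : R) :
  diff_at n f x -> f x <> 0 -> diff_at n (fun y => / f y) x.
Proof.
  intros Hf Hx. revert Hf. induction n as [|n IH]; [trivial|].
  intros Hf. destruct (Hf) as [F1 F2].
  assert (N : locally x (fun y => ex_derive f y /\ f y <> 0)).
  { apply filter_and; [exact F1|]. apply continuous_locally_neq; [|exact Hx].
    apply (ex_derive_continuous (V := R_NormedModule)). exact (locally_singleton _ _ F1). }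
  split.
  - revert N. apply filter_imp. intros y [Df Hy]. now apply ex_derive_inv.
  - apply (diff_at_ext_loc n (fun y => (-1) * (Derive f y * (/ f y * / f y)))).
    + revert N. apply filter_imp. intros y [Df Hy]. rewrite Derive_inv by assumption.
      now field.
    + apply diff_at_scal, diff_at_mult; [exact F2|].
      apply diff_at_mult; apply IH; now apply diff_at_pred.
Qed.

(** * Germs of smooth functions *)

(** One neighbourhood serves all orders: with a neighbourhood depending on [n],
    the set of points of smoothness need not be open, as [smooth_I] demands. *)
Definition smooth_at (f : R -> R) (x : R) : Prop :=
  locally x (fun y => forall n : nat, ex_derive_n f n y).

Lemma smooth_at_locally (f : R -> R) (x : R) :
  smooth_at f x -> locally x (smooth_at f).
Proof. apply locally_locally. Qed.

Lemma smooth_at_ex_derive (f : R -> R) (x : R) : smooth_at f x -> ex_derive f x.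
Proof. intro Hf. exact (locally_singleton _ _ Hf 1%nat). Qed.

Lemma smooth_at_continuous (f : R -> R) (x : R) : smooth_at f x -> continuous f x.
Proof.
  intro Hf. apply (ex_derive_continuous (V := R_NormedModule)).
  now apply smooth_at_ex_derive.
Qed.

Lemma Derive_n_Derive (f : R -> R) (n : nat) (x : R) :
  Derive_n (Derive f) n x = Derive_n f (S n) x.
Proof.
  change (Derive f) with (Derive_n f 1).
  rewrite Derive_n_comp. now rewrite Nat.add_1_r.
Qed.

Lemma smooth_at_Derive (f : R -> R) (x : R) :
  smooth_at f x -> smooth_at (Derive f) x.
Proof.
  unfold smooth_at. apply filter_imp. intros y Hy [|n]; [exact I|].
  simpl. apply (ex_derive_ext (Derive_n f (S n))); [|exact (Hy (S (S n)))].
  intro t. symmetry. apply Derive_n_Derive.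
Qed.

Lemma smooth_at_diff_at (f : R -> R) (x : R) :
  smooth_at f x -> forall n, diff_at n f x.
Proof.
  intros Hf n. revert f Hf. induction n as [|n IH]; intros f Hf; [exact I|].
  split.
  - generalize (smooth_at_locally _ _ Hf). apply filter_imp. intros y.
    apply smooth_at_ex_derive.
  - now apply IH, smooth_at_Derive.
Qed.

Lemma diff_at_ex_derive_n (n : nat) (f : R -> R) (x : R) :
  diff_at n f x -> ex_derive_n f n x.
Proof.
  revert f. induction n as [|n IH]; intros f; [trivial|].
  intros [F1 F2]. destruct n as [|n]; [exact (locally_singleton _ _ F1)|].
  simpl. apply (ex_derive_ext (Derive_n (Derive f) n)); [|exact (IH _ F2)].
  intro t. apply Derive_n_Derive.
Qed.

Lemma diff_at_smooth_at (f : R -> R) (x : R) :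
  locally x (fun y => forall n, diff_at n f y) -> smooth_at f x.
Proof.
  unfold smooth_at. apply filter_imp. intros y Hy n.
  now apply diff_at_ex_derive_n.
Qed.

Lemma smooth_at_ext_loc (f g : R -> R) (x : R) :
  locally x (fun y => f y = g y) -> smooth_at f x -> smooth_at g x.
Proof.
  intros Hfg Hf.
  generalize (filter_and _ _ (locally_locally _ _ Hfg) Hf).
  unfold smooth_at. apply filter_imp. intros y [Hy Hd] n.
  exact (ex_derive_n_ext_loc f g n y Hy (Hd n)).
Qed.

Lemma smooth_at_plus (f g : R -> R) (x : R) :
  smooth_at f x -> smooth_at g x -> smooth_at (fun y => f y + g y) x.
Proof.
  intros Hf Hg. apply diff_at_smooth_at.
  generalize (filter_and _ _ (smooth_at_locally _ _ Hf) (smooth_at_locally _ _ Hg)).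
  apply filter_imp. intros y [H1 H2] n.
  apply diff_at_plus; now apply smooth_at_diff_at.
Qed.

Lemma smooth_at_mult (f g : R -> R) (x : R) :
  smooth_at f x -> smooth_at g x -> smooth_at (fun y => f y * g y) x.
Proof.
  intros Hf Hg. apply diff_at_smooth_at.
  generalize (filter_and _ _ (smooth_at_locally _ _ Hf) (smooth_at_locally _ _ Hg)).
  apply filter_imp. intros y [H1 H2] n.
  apply diff_at_mult; now apply smooth_at_diff_at.
Qed.

Lemma smooth_at_scal (a : R) (f : R -> R) (x : R) :
  smooth_at f x -> smooth_at (fun y => a * f y) x.
Proof.
  intros Hf. apply diff_at_smooth_at.
  generalize (smooth_at_locally _ _ Hf).
  apply filter_imp. intros y Hy n. now apply diff_at_scal, smooth_at_diff_at.
Qed.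

Lemma smooth_at_div (f g : R -> R) (x : R) :
  smooth_at f x -> smooth_at g x -> g x <> 0 -> smooth_at (fun y => f y / g y) x.
Proof.
  intros Hf Hg Hx. apply smooth_at_mult; [exact Hf|]. apply diff_at_smooth_at.
  generalize (filter_and _ _ (smooth_at_locally _ _ Hg)
    (continuous_locally_neq _ _ (smooth_at_continuous _ _ Hg) Hx)).
  apply filter_imp. intros y [H1 H2] n.
  apply diff_at_inv; [now apply smooth_at_diff_at|exact H2].
Qed.

Lemma smooth_at_comp_opp (f : R -> R) (x : R) :
  smooth_at f (- x) -> smooth_at (fun y => f (- y)) x.
Proof.
  intro Hf.
  assert (H : locally x (fun y => smooth_at f (- y))).
  { apply (continuous_opp (V := R_NormedModule) (fun y : R => y) x (continuous_id x)).
    exact (smooth_at_locally _ _ Hf). }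
  revert H. unfold smooth_at at 2. apply filter_imp. intros y Hy n.
  apply ex_derive_n_comp_opp. revert Hy. unfold smooth_at. apply filter_imp. auto.
Qed.

Lemma smooth_at_comp_trans (f : R -> R) (b x : R) :
  smooth_at f (x + b) -> smooth_at (fun y => f (y + b)) x.
Proof.
  intro Hf.
  assert (H : continuous (fun y : R => y + b) x).
  { apply (continuous_plus (V := R_NormedModule)).
    apply continuous_id. apply continuous_const. }
  generalize (H _ Hf). unfold smooth_at, filtermap. apply filter_imp. intros y Hy n.
  apply ex_derive_n_comp_trans. apply Hy.
Qed.

(** The derivative of [phi o h] is [(phi' / c') o h], which has the same shape, with
    [phi] replaced by the smooth function [phi' / c']; hence the induction on the
    order is over all [phi] at once. *)
Lemma smooth_at_comp_inverse (c h phi : R -> R) (y : R) :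
  smooth_at c (h y) -> Derive c (h y) <> 0 ->
  locally y (fun z => is_derive h z (/ Derive c (h z))) ->
  smooth_at phi (h y) -> smooth_at (fun z => phi (h z)) y.
Proof.
  intros Hc Hc' Hh Hphi.
  assert (L : forall phi y, smooth_at c (h y) -> Derive c (h y) <> 0 ->
      locally y (fun z => is_derive h z (/ Derive c (h z))) -> smooth_at phi (h y) ->
      locally y (fun z => smooth_at c (h z) /\ Derive c (h z) <> 0 /\
        locally z (fun z => is_derive h z (/ Derive c (h z))) /\ smooth_at phi (h z))).
  { clear. intros phi y Hc Hc' Hh Hphi.
    assert (Ch : continuous h y).
    { apply (ex_derive_continuous (V := R_NormedModule)).
      exists (/ Derive c (h y)). exact (locally_singleton _ _ Hh). }
    repeat apply filter_and.
    - exact (Ch _ (smooth_at_locally _ _ Hc)).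
    - apply (Ch (fun t => Derive c t <> 0)), continuous_locally_neq; [|exact Hc'].
      now apply smooth_at_continuous, smooth_at_Derive.
    - now apply locally_locally.
    - exact (Ch _ (smooth_at_locally _ _ Hphi)). }
  apply diff_at_smooth_at.
  generalize (L phi y Hc Hc' Hh Hphi). apply filter_imp.
  clear y Hc Hc' Hh Hphi. intros y (Hc & Hc' & Hh & Hphi) n.
  revert phi y Hc Hc' Hh Hphi. induction n as [|n IH]; [now intros|].
  intros phi y Hc Hc' Hh Hphi.
  assert (D : locally y (fun z =>
      is_derive (fun z => phi (h z)) z (Derive phi (h z) / Derive c (h z)))).
  { generalize (L phi y Hc Hc' Hh Hphi). apply filter_imp. intros z (_ & _ & Dh & Dphi).
    unfold Rdiv. rewrite Rmult_comm.
    apply (is_derive_comp (K := R_AbsRing) (V := R_NormedModule)).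
    - now apply Derive_correct, smooth_at_ex_derive.
    - exact (locally_singleton _ _ Dh). }
  split.
  - revert D. apply filter_imp. intros z Hz. now eexists; exact Hz.
  - apply (diff_at_ext_loc n (fun z => (fun t => Derive phi t / Derive c t) (h z))).
    + revert D. apply filter_imp. intros z Hz. symmetry. now apply is_derive_unique.
    + apply (IH (fun t => Derive phi t / Derive c t)); trivial. apply smooth_at_div; trivial; now apply smooth_at_Derive.
Qed.

(** The inverse function theorem on the line: [c'] stays positive on some interval
    [[a, b]] around [x0], so [c] is strictly increasing there and the intermediate
    value theorem provides the inverse. *)
Lemma local_inverse (c : R -> R) (x0 : R) :
  locally x0 (fun x => ex_derive c x) -> continuous (Derive c) x0 -> 0 < Derive c x0 ->
  exists h : R -> R,
    locally (c x0) (fun y => is_derive h y (/ Derive c (h y))) /\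
    locally x0 (fun x => h (c x) = x).
Proof.
  intros Dc Cc' Hpos.
  assert (N : locally x0 (fun x => ex_derive c x /\ 0 < Derive c x)).
  { apply filter_and; [exact Dc|]. apply (Cc' (fun z => 0 < z)).
    exact (open_gt 0 (Derive c x0) Hpos). }
  destruct N as [d Hd].
  assert (d0 := cond_pos d).
  set (a := x0 - d / 2). set (b := x0 + d / 2).
  assert (I : forall x, a <= x <= b -> ex_derive c x /\ 0 < Derive c x).
  { intros x Hx. apply Hd. apply Rabs_def1; unfold minus, plus, opp; simpl; unfold a, b in Hx; lra. }
  assert (Incr : forall x y, a <= x -> x < y -> y <= b -> c x < c y).
  { intros x y Hx Hxy Hy.
    destruct (MVT_gen c x y (Derive c)) as [t [Ht E]].
    - intros t. rewrite Rmin_left, Rmax_right by lra. intro Ht.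
      apply Derive_correct, I. lra.
    - intros t. rewrite Rmin_left, Rmax_right by lra. intro Ht.
      apply continuity_pt_filterlim, (ex_derive_continuous (V := R_NormedModule)), I. lra.
    - rewrite Rmin_left, Rmax_right in Ht by lra.
      assert (0 < Derive c t) by (apply I; lra).
      assert (0 < Derive c t * (y - x)) by (apply Rmult_lt_0_compat; lra). lra. }
  assert (Cont : forall x, a <= x <= b -> continuity_pt c x).
  { intros x Hx.
    apply continuity_pt_filterlim, (ex_derive_continuous (V := R_NormedModule)), I, Hx. }
  assert (ab : a < b) by (unfold a, b; lra).
  set (h := fun y => match Rle_dec (c a) y, Rle_dec y (c b) with
    | left p, left q => proj1_sig (f_interv_is_interv c a b y ab (conj p q) Cont)
    | _, _ => 0 end).
  assert (Hh : forall y, c a <= y -> y <= c b -> a <= h y <= b /\ c (h y) = y).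
  { intros y p q. unfold h.
    destruct (Rle_dec (c a) y) as [p'|]; [|contradiction].
    destruct (Rle_dec y (c b)) as [q'|]; [|contradiction].
    apply proj2_sig. }
  assert (cab : c a < c b) by (apply Incr; lra).
  assert (hc : forall x, a <= x <= b -> h (c x) = x).
  { intros x Hx.
    assert (c a <= c x <= c b) as [p q].
    { split.
      - destruct (Req_dec a x) as [<-|]; [lra|]. apply Rlt_le, Incr; lra.
      - destruct (Req_dec x b) as [->|]; [lra|]. apply Rlt_le, Incr; lra. }
    destruct (Hh _ p q) as [J E].
    destruct (Rtotal_order (h (c x)) x) as [L|[L|L]]; [|exact L|];
      apply Incr in L; lra. }
  exists h. split.
  - assert (c0 : c a < c x0 < c b) by (split; apply Incr; unfold a, b; lra).
    generalize (open_and _ _ (open_gt (c a)) (open_lt (c b)) (c x0) c0).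
    apply filter_imp. intros y Hy.
    assert (Prf : forall t, h (c a) <= t <= h (c b) -> derivable_pt c t).
    { rewrite !hc by lra. intros t Ht. apply ex_derive_Reals_0, I, Ht. }
    assert (Hy' : h (c a) <= h y <= h (c b)).
    { rewrite !hc by lra. apply Hh; lra. }
    assert (Iy : a <= h y <= b) by (apply Hh; lra).
    apply is_derive_Reals.
    replace (/ Derive c (h y)) with (1 / derive_pt c (h y) (Prf (h y) Hy')).
    + apply derivable_pt_lim_recip_interv with (lb := c a) (ub := c b); try assumption.
      * apply (continuity_pt_recip_interv c h a b ab Incr); try assumption.
        -- intros x p q. now apply Hh.
        -- intros x p q. now apply Hh.
      * intros x Hx. now apply Hh.
      * rewrite Derive_Reals. generalize (proj2 (I _ Iy)). lra.
    + rewrite Derive_Reals. unfold Rdiv. ring.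
  - exists (mkposreal (d / 2) ltac:(lra)). intros x Hx. apply hc.
    apply Rabs_def2 in Hx. unfold minus, plus, opp in Hx; simpl in Hx.
    unfold a, b; lra.
Qed.

(** The function is [f = phi o h], with [h] the local inverse of [c]. *)
Lemma smooth_descent_incr (c phi : R -> R) (t0 : R) :
  smooth_at c t0 -> 0 < Derive c t0 -> smooth_at phi t0 ->
  exists f : R -> R, smooth_at f (c t0) /\ locally t0 (fun t => f (c t) = phi t).
Proof.
  intros Hc Hpos Hphi.
  destruct (local_inverse c t0) as [h [Dh hc]].
  - generalize (smooth_at_locally _ _ Hc). apply filter_imp. intros x.
    apply smooth_at_ex_derive.
  - now apply smooth_at_continuous, smooth_at_Derive.
  - exact Hpos.
  - assert (E := locally_singleton _ _ hc). simpl in E.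
    exists (fun y => phi (h y)). split.
    + apply (smooth_at_comp_inverse c); rewrite ?E; trivial. lra.
    + revert hc. apply filter_imp. now intros t ->.
Qed.

Lemma smooth_descent (c phi : R -> R) (t0 : R) :
  smooth_at c t0 -> Derive c t0 <> 0 -> smooth_at phi t0 ->
  exists f : R -> R, smooth_at f (c t0) /\ locally t0 (fun t => f (c t) = phi t).
Proof.
  intros Hc Hnz Hphi.
  destruct (Rtotal_order (Derive c t0) 0) as [L|[L|L]].
  - destruct (smooth_descent_incr (fun t => -1 * c t) phi t0) as [f [Hf Ef]].
    + now apply smooth_at_scal.
    + rewrite Derive_scal. lra.
    + exact Hphi.
    + exists (fun y => f (- y)). split.
      * apply smooth_at_comp_opp. now replace (- c t0) with (-1 * c t0) by ring.
      * revert Ef. apply filter_imp. intros t <-. f_equal. ring.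
  - contradiction.
  - now apply smooth_descent_incr.
Qed.

(** * Power series in the square of the variable *)
Lemma smooth_at_PSeries (a : nat -> R) (x : R) :
  Rbar_lt (Rabs x) (CV_radius a) -> smooth_at (PSeries a) x.
Proof.
  intro Hx.
  assert (L : locally x (fun y => Rbar_lt (Rabs y) (CV_radius a))).
  { apply (continuous_comp (fun y : R => Rabs y) (fun y => y) x (continuous_Rabs x)
      (continuous_id _) (fun z => Rbar_lt z (CV_radius a))).
    exact (open_Rbar_lt' (Rabs x) (CV_radius a) Hx). }
  revert L. unfold smooth_at. apply filter_imp. intros y Hy n.
  now apply ex_derive_n_PSeries.
Qed.

Lemma CV_radius_ge_of_bounded (a : nat -> R) (r M : R) :
  (forall n, Rabs (a n * r ^ n) <= M) -> Rbar_le r (CV_radius a).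
Proof. intro H. apply (proj1 (CV_radius_bounded a)). now exists M. Qed.

Lemma is_pseries_bounded (a : nat -> R) (x l : R) :
  is_pseries a x l -> exists M, forall n, Rabs (a n * x ^ n) <= M.
Proof.
  intro H. apply is_pseries_R in H.
  assert (E : ex_series (fun n => a n * x ^ n)) by (now exists l).
  apply ex_series_lim_0 in E.
  destruct (filterlim_bounded (K := R_AbsRing) (V := R_NormedModule) (fun n => a n * x ^ n)) as [M HM].
  { exists 0. exact E. }
  now exists M.
Qed.

Lemma real_analytic_smooth_at (F : R -> R) (x : R) : real_analytic F -> smooth_at F x.
Proof.
  intro HF. destruct (HF x) as (a & r & r0 & Ha).
  apply (smooth_at_ext_loc (fun y => PSeries a (y + - x))).
  - exists (mkposreal r r0). intros y Hy. apply is_pseries_unique. apply (Ha y Hy).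
  - apply (smooth_at_comp_trans (PSeries a) (- x) x).
    apply smooth_at_PSeries. rewrite Rplus_opp_r, Rabs_R0.
    assert (B : is_pseries a (r / 2) (F (x + r / 2))).
    { replace (r / 2) with (x + r / 2 - x) at 1 by ring. apply Ha.
      apply Rabs_def1; lra. }
    destruct (is_pseries_bounded _ _ _ B) as [M HM].
    apply Rbar_lt_le_trans with (r / 2); [simpl; lra|].
    exact (CV_radius_ge_of_bounded _ _ _ HM).
Qed.

(** Group the even and the odd exponents of the power series at [x0].  The two
    resulting series in [t ^ 2] converge because boundedness of [a n * s ^ n]
    passes to the subsequences. *)
Lemma real_analytic_parity_split (F : R -> R) (x0 : R) :
  real_analytic F ->
  exists p q : R -> R, smooth_at p 0 /\ smooth_at q 0 /\
    locally 0 (fun t => F (x0 + t) = p (t ^ 2) + t * q (t ^ 2)).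
Proof.
  intro HF. destruct (HF x0) as (a & r & r0 & Ha).
  set (s := r / 2).
  assert (s0 : 0 < s) by (unfold s; lra).
  assert (B : is_pseries a s (F (x0 + s))).
  { replace s with (x0 + s - x0) at 1 by ring. apply Ha.
    apply Rabs_def1; unfold s; lra. }
  destruct (is_pseries_bounded _ _ _ B) as [M HM].
  assert (s20 : 0 < s ^ 2) by (now apply pow_lt).
  assert (Re : Rbar_le (s ^ 2) (CV_radius (fun n => a (2 * n)%nat))).
  { apply CV_radius_ge_of_bounded with M. intro n. rewrite <- pow_mult. apply HM. }
  assert (Ro : Rbar_le (s ^ 2) (CV_radius (fun n => a (2 * n + 1)%nat))).
  { apply CV_radius_ge_of_bounded with (M / s). intro n. rewrite <- pow_mult.
    apply Rmult_le_reg_r with s; [exact s0|].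
    replace (M / s * s) with M by (field; lra).
    rewrite <- (Rabs_pos_eq s) at 2 by lra. rewrite <- Rabs_mult.
    replace (a (2 * n + 1)%nat * s ^ (2 * n) * s)
      with (a (2 * n + 1)%nat * s ^ (2 * n + 1)) by (rewrite pow_add; ring).
    apply HM. }
  exists (PSeries (fun n => a (2 * n)%nat)), (PSeries (fun n => a (2 * n + 1)%nat)).
  split; [|split].
  - apply smooth_at_PSeries. rewrite Rabs_R0. now apply Rbar_lt_le_trans with (s ^ 2).
  - apply smooth_at_PSeries. rewrite Rabs_R0. now apply Rbar_lt_le_trans with (s ^ 2).
  - exists (mkposreal s s0). intros t Ht.
    apply Rabs_def2 in Ht. unfold minus, plus, opp in Ht; simpl in Ht.
    assert (Rabs (t ^ 2) < s ^ 2).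
    { apply Rabs_def1; nra. }
    rewrite <- PSeries_odd_even.
    + symmetry. apply is_pseries_unique.
      replace t with (x0 + t - x0) at 1 by ring. apply Ha.
      apply Rabs_def1; unfold s in Ht; lra.
    + apply CV_radius_inside. now apply Rbar_lt_le_trans with (s ^ 2).
    + apply CV_radius_inside. now apply Rbar_lt_le_trans with (s ^ 2).
Qed.

Lemma CV_radius_infinite (a : nat -> R) (l : R -> R) :
  (forall x, 0 <= x -> is_pseries a x (l x)) -> CV_radius a = p_infty.
Proof.
  intro H. assert (K : forall r, 0 <= r -> Rbar_le r (CV_radius a)).
  { intros r Hr. destruct (is_pseries_bounded _ _ _ (H r Hr)) as [M HM].
    exact (CV_radius_ge_of_bounded _ _ _ HM). }
  destruct (CV_radius a) as [R0| |]; [|reflexivity|].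
  - exfalso. generalize (K (Rmax 0 (R0 + 1)) (Rmax_l _ _)). simpl.
    generalize (Rmax_r 0 (R0 + 1)). lra.
  - destruct (K 0 (Rle_refl 0)).
Qed.

Lemma cos_PSeries_sqr :
  CV_radius cos_n = p_infty /\ forall t, cos t = PSeries cos_n (t ^ 2).
Proof.
  assert (H : forall x, is_pseries cos_n x (proj1_sig (exist_cos x))).
  { intro x. apply is_pseries_R, is_series_Reals. exact (proj2_sig (exist_cos x)). }
  split.
  - apply (CV_radius_infinite _ (fun x => proj1_sig (exist_cos x))). auto.
  - intro t. replace (t ^ 2) with (Rsqr t) by (unfold Rsqr; ring).
    rewrite (is_pseries_unique _ _ _ (H (Rsqr t))).
    unfold cos. now destruct (exist_cos (Rsqr t)).
Qed.

Lemma sin_PSeries_sqr :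
  CV_radius sin_n = p_infty /\ forall t, sin t = t * PSeries sin_n (t ^ 2).
Proof.
  assert (H : forall x, is_pseries sin_n x (proj1_sig (exist_sin x))).
  { intro x. apply is_pseries_R, is_series_Reals. exact (proj2_sig (exist_sin x)). }
  split.
  - apply (CV_radius_infinite _ (fun x => proj1_sig (exist_sin x))). auto.
  - intro t. replace (t ^ 2) with (Rsqr t) by (unfold Rsqr; ring).
    rewrite (is_pseries_unique _ _ _ (H (Rsqr t))).
    unfold sin. now destruct (exist_sin (Rsqr t)).
Qed.

Lemma diff_at_sin_cos (n : nat) (x : R) : diff_at n sin x /\ diff_at n cos x.
Proof.
  induction n as [|n [IHs IHc]]; [now split|].
  split; split.
  - apply filter_forall. intro y. exists (cos y). apply is_derive_sin.
  - apply (diff_at_ext_loc n cos); [|exact IHc]. apply filter_forall. intro y.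
    symmetry. apply is_derive_unique, is_derive_sin.
  - apply filter_forall. intro y. exists (- sin y). apply is_derive_cos.
  - apply (diff_at_ext_loc n (fun y => -1 * sin y)); [|now apply diff_at_scal].
    apply filter_forall. intro y. rewrite (is_derive_unique _ _ _ (is_derive_cos y)).
    simpl. ring.
Qed.

Lemma smooth_at_cos (x : R) : smooth_at cos x.
Proof. apply diff_at_smooth_at, filter_forall. intros y n. apply diff_at_sin_cos. Qed.

Lemma smooth_at_sin (x : R) : smooth_at sin x.
Proof. apply diff_at_smooth_at, filter_forall. intros y n. apply diff_at_sin_cos. Qed.

(** * Smooth functions of the cosine *)

(** The derivative of [cos] vanishes at [0], so descent along [cos] is impossible for
    a general smooth function; but [cos t = c (t ^ 2)] with [c' 0 = - 1 / 2], so a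
    smooth function of [t ^ 2] descends along [c]. *)
Lemma smooth_descent_cos_0 (phi : R -> R) :
  smooth_at phi 0 ->
  exists f : R -> R, smooth_at f 1 /\ locally 0 (fun t => f (cos t) = phi (t ^ 2)).
Proof.
  intro Hphi. destruct cos_PSeries_sqr as [Rc Ec].
  destruct (smooth_descent (PSeries cos_n) phi 0) as [f [Hf Ef]].
  - apply smooth_at_PSeries. now rewrite Rc.
  - rewrite Derive_PSeries by now rewrite Rc. rewrite PSeries_0.
    unfold PS_derive, cos_n. simpl. lra.
  - exact Hphi.
  - exists f. split.
    + replace 1 with (PSeries cos_n 0); [exact Hf|].
      rewrite <- cos_0, Ec. f_equal. ring.
    + assert (C : continuous (fun t : R => t ^ 2) 0).
      { apply (ex_derive_continuous (V := R_NormedModule)). auto_derive. trivial. }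
      replace 0 with (0 ^ 2) in Ef at 1 by ring.
      generalize (C _ Ef). unfold filtermap. apply filter_imp.
      intros t Ht. now rewrite Ec.
Qed.

(** One-sided continuity of [acos] at [1], from the monotonicity of [cos]. *)
Lemma locally_acos_near_1 (P : R -> Prop) :
  locally 0 P -> locally 1 (fun y => -1 < y < 1 -> P (acos y)).
Proof.
  intros [d Hd]. assert (d0 := cond_pos d). assert (pi0 := PI_RGT_0).
  set (e := Rmin d PI).
  assert (e0 : 0 < e) by (apply Rmin_pos; lra).
  assert (ed := Rmin_l d PI). assert (ep := Rmin_r d PI). fold e in ed, ep.
  assert (C : cos e < 1).
  { rewrite <- cos_0. apply cos_decreasing_1; lra. }
  generalize (open_gt (cos e) 1 C). apply filter_imp. intros y Hy I.
  destruct (acos_bound_lt y I) as [A1 A2].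
  assert (acos y < e).
  { apply cos_decreasing_0; try lra. rewrite cos_acos by lra. exact Hy. }
  apply Hd. apply Rabs_def1; unfold minus, plus, opp; simpl; lra.
Qed.

Lemma locally_opp (P : R -> Prop) (x y : R) :
  y = - x -> locally y P -> locally x (fun z => P (- z)).
Proof.
  intros ->.
  exact (continuous_opp (V := R_NormedModule) (fun y : R => y) x (continuous_id x) P).
Qed.

(** The hypotheses at the two ends concern only [t > 0], since for [E = O / sin] the
    value at [0] is an accident of division by zero.  The values of [f] at [1] and
    [-1] are given separately for the same reason. *)
Lemma even_descent (E phi psi : R -> R) :
  (forall t, 0 < t < PI -> smooth_at E t) ->
  smooth_at phi 0 -> smooth_at psi 0 ->
  locally 0 (fun t => 0 < t -> E t = phi (t ^ 2)) ->
  locally 0 (fun t => 0 < t -> E (PI - t) = psi (t ^ 2)) ->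
  exists f : R -> R, smooth_I f /\
    (forall t, 0 < t < PI -> f (cos t) = E t) /\ f 1 = phi 0 /\ f (-1) = psi 0.
Proof.
  intros HE Hphi Hpsi E0 Epi.
  destruct (smooth_descent_cos_0 phi Hphi) as [f1 [S1 D1]].
  destruct (smooth_descent_cos_0 psi Hpsi) as [f2 [S2 D2]].
  (* Inside the interval the formula is forced; outside, it continues the local
     solution at the nearest endpoint. *)
  set (f := fun x => if Rlt_dec x 1 then
    if Rlt_dec (-1) x then E (acos x) else f2 (- x) else f1 x).
  assert (fin : forall x, -1 < x < 1 -> f x = E (acos x)).
  { intros x Hx. unfold f. destruct (Rlt_dec x 1); [|lra].
    destruct (Rlt_dec (-1) x); [reflexivity|lra]. }
  assert (fr : forall x, 1 <= x -> f x = f1 x).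
  { intros x Hx. unfold f. destruct (Rlt_dec x 1); [lra|reflexivity]. }
  assert (fl : forall x, x <= -1 -> f x = f2 (- x)).
  { intros x Hx. unfold f. destruct (Rlt_dec x 1); [|lra].
    destruct (Rlt_dec (-1) x); [lra|reflexivity]. }
  exists f. split; [|split; [|split]].
  - exists (smooth_at f). split; [exact (smooth_at_locally f)|split].
    2: { intros n x Hx. exact (locally_singleton _ _ Hx n). }
    intros x Hx.
    destruct (Req_dec x 1) as [->|n1]; [|destruct (Req_dec x (-1)) as [->|n2]].
    + apply (smooth_at_ext_loc f1); [|exact S1].
      assert (A : -1 < 1) by lra.
      generalize (filter_and _ _ (open_gt (-1) 1 A)
        (locally_acos_near_1 _ (filter_and _ _ D1 E0))).
      apply filter_imp. intros y [y1 Hy].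
      destruct (Rle_lt_dec 1 y) as [L|L]; [now rewrite fr|].
      assert (I : -1 < y < 1) by lra.
      destruct (Hy I) as [H1 H2]. rewrite fin, H2, <- H1, cos_acos by
        (try apply acos_bound_lt; lra). reflexivity.
    + apply (smooth_at_ext_loc (fun y => f2 (- y))).
      2: { apply smooth_at_comp_opp. now replace (- -1) with 1 by ring. }
      assert (A : -1 < 1) by lra.
      assert (A' : 1 = - -1) by ring.
      generalize (filter_and _ _ (open_lt 1 (-1) A)
        (locally_opp _ (-1) 1 A' (locally_acos_near_1 _ (filter_and _ _ D2 Epi)))).
      apply filter_imp. intros y [y1 Hy].
      destruct (Rle_lt_dec y (-1)) as [L|L]; [now rewrite fl|].
      assert (I : -1 < - y < 1) by lra.
      destruct (Hy I) as [H1 H2].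
      rewrite fin by lra. replace (acos y) with (PI - acos (- y))
        by (rewrite acos_opp; ring).
      rewrite H2, <- H1, cos_acos by (try apply acos_bound_lt; lra). reflexivity.
    + assert (I : -1 < x < 1) by lra.
      assert (B := acos_bound_lt x I).
      assert (sn : 0 < sin (acos x)) by (apply sin_gt_0; lra).
      destruct (smooth_descent cos E (acos x)) as [g [Sg Dg]].
      * apply smooth_at_cos.
      * rewrite (is_derive_unique _ _ _ (is_derive_cos (acos x))). simpl. lra.
      * now apply HE.
      * rewrite cos_acos in Sg by lra.
        apply (smooth_at_ext_loc g); [|exact Sg].
        assert (C : continuous acos x).
        { apply continuity_pt_filterlim, derivable_continuous_pt.
          now apply derivable_pt_acos. }
        assert (Dx : locally x (fun y => g (cos (acos y)) = E (acos y)))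
          by exact (C _ Dg).
        generalize (filter_and _ _ Dx (open_and _ _ (open_gt (-1)) (open_lt 1) x I)).
        apply filter_imp. intros y [Hy Iy]. rewrite fin by exact Iy.
        rewrite <- Hy, cos_acos by lra. reflexivity.
  - intros t Ht.
    assert (-1 < cos t < 1).
    { split; [rewrite <- cos_PI|rewrite <- cos_0]; apply cos_decreasing_1; lra. }
    rewrite fin by assumption. now rewrite acos_cos by lra.
  - rewrite fr by lra. generalize (locally_singleton _ _ D1). simpl.
    rewrite cos_0. intros ->. f_equal. ring.
  - rewrite fl by lra. generalize (locally_singleton _ _ D2). simpl.
    replace (- -1) with 1 by ring. rewrite cos_0. intros ->. f_equal. ring.
Qed.

(** * The decomposition *)
Lemma periodic_everywhere (P : R -> Prop) :
  (forall t, P t <-> P (t + 2 * PI)) -> (forall t, - PI <= t <= PI -> P t) ->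
  forall t, P t.
Proof.
  intros Per HP.
  assert (K : forall n t, - PI <= t + IZR (Z.of_nat n) * (2 * PI) <= PI \/
     - PI <= t - IZR (Z.of_nat n) * (2 * PI) <= PI -> P t).
  { induction n as [|n IH]; intros t [H|H].
    - apply HP. simpl in H. lra.
    - apply HP. simpl in H. lra.
    - apply Per, IH. left. rewrite Nat2Z.inj_succ, succ_IZR in H. lra.
    - replace t with (t - 2 * PI + 2 * PI) by ring. apply -> Per. apply IH. right.
      rewrite Nat2Z.inj_succ, succ_IZR in H. lra. }
  intro t. assert (pi0 := PI_RGT_0).
  set (u := (t + PI) / (2 * PI)).
  assert (Hu : t + PI = u * (2 * PI)) by (unfold u; field; lra).
  destruct (base_Int_part u) as [B1 B2].
  assert (H : - PI <= t - IZR (Int_part u) * (2 * PI) <= PI).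
  { assert (0 <= (u - IZR (Int_part u)) * (2 * PI)) by (apply Rmult_le_pos; lra).
    assert ((u - IZR (Int_part u)) * (2 * PI) <= 1 * (2 * PI))
      by (apply Rmult_le_compat_r; lra). lra. }
  destruct (Z_le_gt_dec 0 (Int_part u)) as [Z0|Z0].
  - apply (K (Z.to_nat (Int_part u))). right. now rewrite Z2Nat.id.
  - apply (K (Z.to_nat (- Int_part u))). left. rewrite Z2Nat.id by lia.
    rewrite opp_IZR. lra.
Qed.

Lemma cos_decomposition_exists (F : R -> R) :
  real_analytic F -> (forall t, F (t + 2 * PI) = F t) ->
  exists f g : R -> R, smooth_I f /\ smooth_I g /\
    forall t, F t = f (cos t) + g (cos t) * sin t.
Proof.
  intros HF Per. assert (pi0 := PI_RGT_0).
  assert (SF : forall t, smooth_at F t /\ smooth_at (fun y => F (- y)) t).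
  { intro t. split; [|apply smooth_at_comp_opp]; now apply real_analytic_smooth_at. }
  set (E := fun t => / 2 * (F t + F (- t))).
  set (G := fun t => (/ 2 * (F t + -1 * F (- t))) / sin t).
  destruct (real_analytic_parity_split F 0 HF) as (p & q & Sp & Sq & H0).
  destruct (real_analytic_parity_split F PI HF) as (p1 & q1 & Sp1 & Sq1 & Hpi).
  assert (H0' := locally_opp _ 0 0 (eq_sym Ropp_0) H0).
  assert (Hpi' := locally_opp _ 0 0 (eq_sym Ropp_0) Hpi).
  destruct sin_PSeries_sqr as [Rs Es].
  set (s := PSeries sin_n) in Es.
  assert (Ss : smooth_at s 0) by (apply smooth_at_PSeries; now rewrite Rs).
  assert (s0 : s 0 <> 0).
  { unfold s. rewrite PSeries_0. unfold sin_n. simpl. lra. }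
  (* Reflection at [0] acts as reflection at [PI], by periodicity. *)
  assert (Fpi : forall t, F (- (PI - t)) = F (PI + t)).
  { intro t. rewrite <- (Per (- (PI - t))). f_equal. ring. }
  destruct (even_descent E p p1) as (f & Sf & If & f1 & fm1).
  { intros t _. apply smooth_at_scal, smooth_at_plus; apply SF. }
  { exact Sp. }
  { exact Sp1. }
  { generalize (filter_and _ _ H0 H0'). apply filter_imp. intros t [A B] _.
    unfold E. replace (- t) with (0 + - t) by ring.
    rewrite <- (Rplus_0_l t) at 1. rewrite A, B.
    replace ((- t) ^ 2) with (t ^ 2) by ring. field. }
  { generalize (filter_and _ _ Hpi Hpi'). apply filter_imp. intros t [A B] _.
    unfold E. rewrite Fpi. unfold Rminus. rewrite A, B.
    replace ((- t) ^ 2) with (t ^ 2) by ring. field. }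
  destruct (even_descent G (fun x => q x / s x) (fun x => -1 * q1 x / s x))
    as (g & Sg & Ig & _ & _).
  { intros t Ht. apply smooth_at_div.
    - apply smooth_at_scal, smooth_at_plus; [|apply smooth_at_scal]; apply SF.
    - apply smooth_at_sin.
    - generalize (sin_gt_0 t). lra. }
  { now apply smooth_at_div. }
  { apply smooth_at_div; trivial. now apply smooth_at_scal. }
  { generalize (filter_and _ _ H0 H0'). apply filter_imp. intros t [A B] Ht.
    unfold G. replace (- t) with (0 + - t) by ring.
    rewrite <- (Rplus_0_l t) at 1. rewrite A, B, Es.
    replace ((- t) ^ 2) with (t ^ 2) by ring. unfold Rdiv. rewrite Rinv_mult.
    (* Only [t] is known to be nonzero here, so [/ s (t ^ 2)] is kept opaque. *)
    generalize (/ s (t ^ 2)). intro u. field. lra. }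
  { generalize (filter_and _ _ Hpi Hpi'). apply filter_imp. intros t [A B] Ht.
    unfold G. rewrite Fpi. unfold Rminus. rewrite A, B.
    fold (PI - t). rewrite sin_PI_x, Es.
    replace ((- t) ^ 2) with (t ^ 2) by ring. unfold Rdiv. rewrite Rinv_mult.
    generalize (/ s (t ^ 2)). intro u. field. lra. }
  exists f, g. split; [exact Sf|]. split; [exact Sg|].
  assert (K : forall t, 0 <= t <= PI ->
    E t = f (cos t) /\ / 2 * (F t + -1 * F (- t)) = g (cos t) * sin t).
  { intros t Ht.
    destruct (Req_dec t 0) as [->|n1]; [|destruct (Req_dec t PI) as [->|n2]].
    - rewrite cos_0, sin_0, f1. unfold E. rewrite Ropp_0.
      generalize (locally_singleton _ _ H0). simpl. rewrite Rplus_0_l. intros ->.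
      split; [|ring]. replace (0 * (0 * 1)) with 0 by ring. field.
    - rewrite cos_PI, sin_PI, fm1. unfold E.
      generalize (locally_singleton _ _ Hpi) (Fpi 0). simpl.
      rewrite Rminus_0_r, Rplus_0_r. intros A ->. rewrite A.
      split; [|ring]. replace (0 * (0 * 1)) with 0 by ring. field.
    - assert (0 < sin t) by (apply sin_gt_0; lra).
      rewrite If, Ig by lra. split; [reflexivity|]. unfold G. field. lra. }
  apply periodic_everywhere.
  - intro t. rewrite Per, cos_plus, sin_plus, cos_2PI, sin_2PI.
    replace (cos t * 1 - sin t * 0) with (cos t) by ring.
    replace (sin t * 1 + cos t * 0) with (sin t) by ring. reflexivity.
  - intros t Ht. destruct (Rle_lt_dec 0 t) as [L|L].
    + destruct (K t) as [A B]; [lra|]. rewrite <- A, <- B. unfold E. field.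
    + destruct (K (- t)) as [A B]; [lra|].
      rewrite cos_neg in A, B. rewrite sin_neg in B. unfold E in A.
      rewrite Ropp_involutive in A, B. lra.
Qed.

Lemma smooth_I_continuous (f : R -> R) (x : R) :
  smooth_I f -> -1 <= x <= 1 -> continuous f x.
Proof.
  intros (U & _ & HU & Hf) Hx. apply (ex_derive_continuous (V := R_NormedModule)).
  exact (Hf 1%nat x (HU x Hx)).
Qed.

Lemma eq_on_I_of_interior (f g : R -> R) :
  smooth_I f -> smooth_I g -> (forall x, -1 < x < 1 -> f x = g x) -> eq_on_I f g.
Proof.
  intros Sf Sg H x Hx.
  assert (C : continuous (fun y => f y - g y) x).
  { apply (continuous_minus (V := R_NormedModule)); now apply smooth_I_continuous. }
  destruct (Req_dec (f x - g x) 0) as [Z|Z]; [lra|exfalso].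
  destruct (continuous_locally_neq (fun y => f y - g y) x C Z) as [d Hd].
  assert (d0 := cond_pos d).
  (* Moving from [x] by the fraction [l] towards [0] enters the open interval. *)
  set (l := Rmin (d / 2) 1).
  assert (l0 : 0 < l) by (apply Rmin_pos; lra).
  assert (l1 := Rmin_l (d / 2) 1). assert (l2 := Rmin_r (d / 2) 1). fold l in l1, l2.
  apply (Hd (x - l * x)).
  - apply Rabs_def1; unfold minus, plus, opp; simpl; nra.
  - rewrite H; [ring|]. nra.
Qed.

Lemma cos_decomposition_unique (F f g f1 g1 : R -> R) :
  smooth_I g -> smooth_I g1 ->
  (forall t, F t = f (cos t) + g (cos t) * sin t) ->
  (forall t, F t = f1 (cos t) + g1 (cos t) * sin t) ->
  eq_on_I f1 f /\ eq_on_I g1 g.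
Proof.
  intros Sg Sg1 H H1.
  assert (K : forall t, f1 (cos t) = f (cos t) /\ g1 (cos t) * sin t = g (cos t) * sin t).
  { intro t. generalize (H t) (H (- t)) (H1 t) (H1 (- t)).
    rewrite cos_neg, sin_neg. lra. }
  split.
  - intros x Hx. rewrite <- (cos_acos x) by exact Hx. apply K.
  - apply eq_on_I_of_interior; trivial. intros x Hx.
    destruct (K (acos x)) as [_ E]. rewrite cos_acos in E by lra.
    apply Rmult_eq_reg_r in E; [exact E|].
    assert (B := acos_bound_lt x Hx). generalize (sin_gt_0 (acos x)). lra.
Qed.

Lemma exists_unique_cos_decomposition (F : R -> R) :
  real_analytic F -> (forall t, F (t + 2 * PI) = F t) ->
  exists_unique_smooth_pair (fun f g =>
    forall t, F t = f (cos t) + g (cos t) * sin t).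
Proof.
  intros HF Per.
  destruct (cos_decomposition_exists F HF Per) as (f & g & Sf & Sg & H).
  exists f, g. split; [tauto|]. intros f1 g1 _ Sg1 H1.
  now apply (cos_decomposition_unique F).
Qed.

Lemma real_analytic_reflect (F : R -> R) (b : R) :
  real_analytic F -> real_analytic (fun t => F (b - t)).
Proof.
  intros HF x0. destruct (HF (b - x0)) as (a & r & r0 & Ha).
  exists (fun n => a n * (-1) ^ n), r. split; [exact r0|]. intros x Hx.
  assert (K : is_pseries a (b - x - (b - x0)) (F (b - x))).
  { apply Ha. replace (b - x - (b - x0)) with (- (x - x0)) by ring.
    now rewrite Rabs_Ropp. }
  apply is_pseries_R in K. apply is_pseries_R.
  apply (is_series_ext (fun n => a n * (b - x - (b - x0)) ^ n)); [|exact K].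
  intro n. rewrite Rmult_assoc, <- Rpow_mult_distr. do 2 f_equal. ring.
Qed.

Theorem theorem2p4 (F : R -> R)
    (F_analytic : real_analytic F)
    (F_periodic : forall theta : R, F (theta + 2 * PI) = F theta) :
  exists_unique_smooth_pair (fun f g =>
    forall theta : R, F theta = f (sin theta) + g (sin theta) * cos theta) /\
  exists_unique_smooth_pair (fun f g =>
    forall theta : R, F theta = f (cos theta) + g (cos theta) * sin theta).
Proof.
  split; [|now apply exists_unique_cos_decomposition].
  destruct (exists_unique_cos_decomposition (fun t => F (PI / 2 - t)))
    as (f & g & (Sf & Sg & H) & U).
  - now apply real_analytic_reflect.
  - intro t. rewrite <- F_periodic. f_equal. ring.
  - exists f, g. split; [split; [exact Sf|split; [exact Sg|]]|].
    + intro t. generalize (H (PI / 2 - t)). rewrite cos_shift, sin_shift.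
      intros <-. f_equal. ring.
    + intros f1 g1 Sf1 Sg1 H1. apply U; trivial.
      intro t. now rewrite H1, cos_shift, sin_shift.
Qed.
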